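(* Let $t$ be an $\mathrm{SL}_2$-tiling with no entry equal to $1$. Then $t$ has a unique minimal entry, that is, there is exactly one pair $(b,v)\in\mathbb{Z}\times\mathbb{Z}$ such that $t(b,v)=\min\{t(i,j)\mid i,j\in\mathbb{Z}\}$.
   Context: An $\mathrm{SL}_2$-tiling is a map $t:\mathbb{Z}\times\mathbb{Z}\to\{1,2,3,\ldots\}$ with $t(i,j)t(i+1,j+1)-t(i,j+1)t(i+1,j)=1$ for all $i,j\in\mathbb{Z}$; its values $t(i,j)$ are called its entries. *)

(* Defs.v *)
From mathcomp Require Import all_boot all_order all_algebra.

Set Implicit Arguments.
Unset Strict Implicit.
Unset Printing Implicit Defensive.

Import Order.TTheory GRing.Theory Num.Theory.
Local Open Scope ring_scope.

(* The entries are typed in [int], so that the subtraction is not truncated;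
   the codomain {1, 2, 3, ...} is the positivity condition. *)
Definition is_SL2_tiling (t : int -> int -> int) : Prop :=
  (forall i j : int, 0 < t i j) /\
  (forall i j : int,
     t i j * t (i + 1) (j + 1) - t i (j + 1) * t (i + 1) j = 1).

Definition is_min_of_entries (t : int -> int -> int) (m : int) : Prop :=
  (exists i j : int, t i j = m) /\ (forall i j : int, m <= t i j).

(* Main.v *)
Require Import Defs.
From mathcomp Require Import all_boot all_order all_algebra.
From mathcomp Require Import zify ring.
From Stdlib Require Import Classical.

Set Implicit Arguments.
Unset Strict Implicit.
Unset Printing Implicit Defensive.

Import Order.TTheory GRing.Theory Num.Theory.
Local Open Scope ring_scope.

(** Adjacent entries of an SL_2-tiling are coprime, so a minimum m >= 2 is
    strictly smaller than its four neighbours.  The point is to propagate this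
    to the whole tiling.

    Let (i, j) and (k, l) be two positions with the same minimal value m.  If
    i < k and j < l, then the rectangle they span has a positive 2 x 2
    determinant, because ratios of consecutive rows are strictly monotone
    ([cross_ratio_lt]).  It is m ^ 2 minus the product of the other two
    corners, and this product is at least m ^ 2: a contradiction.

    The other case, up to exchanging the two positions, is i <= k and l <= j.
    Reversing the columns gives an array g on the quadrant nat x nat with
    g 0 0 = g p q = m, and [min_corner_lt] shows p = q = 0.  The mechanism is
    the linear recurrence (row r) + (row r + 2) = a * (row r + 1), with a
    positive integer a, and its analogue for columns.  A row with a = 1 is the
    sum of its neighbours, and it can be deleted: what remains is an array of
    the same kind ([rev_tiling_del_row]).  So one may assume, by induction on
    p + q, that all the coefficients a strictly between 0 and p, and likewise
    for columns between 0 and q, are at least 2.  Rows and columns are then convex, hence they keep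
    increasing away from the corner (0, 0), and g p q > m
    ([convex_corner_lt]). *)

(** * Tilings of a quadrant with reversed columns *)

(** The sign is the one that the tiling rule takes when the order of the columns
    is reversed; in this form the rule is invariant under transposition. *)
Definition rev_tiling (g : nat -> nat -> int) : Prop :=
  forall r c, g r c.+1 * g r.+1 c - g r c * g r.+1 c.+1 = 1.

(** The coefficient of the recurrence between the rows r, r + 1 and r + 2; as a
    determinant it is visibly an integer. *)
Definition row_coef (g : nat -> nat -> int) (r c : nat) : int :=
  g r c.+1 * g r.+2 c - g r c * g r.+2 c.+1.

Lemma rev_tiling_tr g : rev_tiling g -> rev_tiling (fun r c => g c r).
Proof. by move=> hg r c; have := hg c r; rewrite [g c r.+1 * _]mulrC. Qed.

Lemma row_coefE g r c : rev_tiling g ->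
  g r c + g r.+2 c = row_coef g r c * g r.+1 c.
Proof.
move=> hg; have e1 := hg r c; have e2 := hg r.+1 c; rewrite /row_coef.
transitivity (g r c * (g r.+1 c.+1 * g r.+2 c - g r.+1 c * g r.+2 c.+1)
  + g r.+2 c * (g r c.+1 * g r.+1 c - g r c * g r.+1 c.+1)).
  by rewrite e1 e2 !mulr1.
by ring.
Qed.

Lemma row_coefES g r c : rev_tiling g ->
  g r c.+1 + g r.+2 c.+1 = row_coef g r c * g r.+1 c.+1.
Proof.
move=> hg; have e1 := hg r c; have e2 := hg r.+1 c; rewrite /row_coef.
transitivity (g r c.+1 * (g r.+1 c.+1 * g r.+2 c - g r.+1 c * g r.+2 c.+1)
  + g r.+2 c.+1 * (g r c.+1 * g r.+1 c - g r c * g r.+1 c.+1)).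
  by rewrite e1 e2 !mulr1.
by ring.
Qed.

(** [row_coefE] at column c + 1 and [row_coefES] at column c express the same sum
    with the coefficients of two adjacent columns, so these coincide. *)
Lemma row_coef0 g r c : rev_tiling g -> (forall r c, 0 < g r c) ->
  row_coef g r c = row_coef g r 0.
Proof.
move=> hg gpos; elim: c => [//|c <-].
have nz : g r.+1 c.+1 != 0 by rewrite gt_eqF.
by apply: (mulIf nz); rewrite -row_coefE // row_coefES.
Qed.

Lemma row_rec g r c : rev_tiling g -> (forall r c, 0 < g r c) ->
  g r c + g r.+2 c = row_coef g r 0 * g r.+1 c.
Proof. by move=> hg gpos; rewrite row_coefE // (@row_coef0 g r c). Qed.

Lemma row_coef_gt0 g r : rev_tiling g -> (forall r c, 0 < g r c) ->
  0 < row_coef g r 0.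
Proof.
move=> hg gpos; rewrite -(pmulr_lgt0 _ (gpos r.+1 0%N)) -row_coefE //.
by rewrite addr_gt0.
Qed.

(** Row r + 1 is the sum of its neighbours when the coefficient is 1; the two
    rows that become adjacent then have determinants equal to that 1. *)
Lemma rev_tiling_del_row g r0 : rev_tiling g -> (forall r c, 0 < g r c) ->
  row_coef g r0 0 = 1 -> rev_tiling (fun r c => g (bump r0.+1 r) c).
Proof.
move=> hg gpos a1 r c; rewrite /bump.
case: (ltngtP r r0) => [lt_r|gt_r|->].
- have -> : (r0 < r.+1)%N = false by lia.
  by rewrite !add0n.
- have -> : (r0 < r.+1)%N by lia.
  by rewrite !add1n.
- by rewrite leqnn add0n add1n -[RHS]a1 -(@row_coef0 g r0 c).
Qed.

(** * Growth away from a minimal corner *)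

(** A nonnegative solution of the recurrence is convex while the coefficients are
    at least 2, so its increments never drop below the first one. *)
Lemma convex_rec (x b : nat -> int) (p : nat) :
    (forall r, (r.+1 < p)%N -> 2 <= b r) ->
    (forall r, x r + x r.+2 = b r * x r.+1) ->
    0 <= x 0%N -> x 0%N <= x 1%N ->
  forall r, (r < p)%N -> x 0%N <= x r /\ x 1%N - x 0%N <= x r.+1 - x r.
Proof.
move=> hb hx x0 x01; elim=> [|r IH] ltp; first by split; lia.
have [h1 h2] := IH (ltnW ltp).
have := hb r ltp; have := hx r => e b2; split; first by lia.
have : 0 <= (b r - 2) * x r.+1 by apply: mulr_ge0; lia.
by rewrite mulrBl -e; lia.
Qed.

Lemma convex_rec_ge (x b : nat -> int) (p : nat) :
    (forall r, (r.+1 < p)%N -> 2 <= b r) ->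
    (forall r, x r + x r.+2 = b r * x r.+1) ->
    0 <= x 0%N -> x 0%N <= x 1%N -> (0 < p)%N -> x 1%N <= x p.
Proof.
move=> hb hx x0 x01; case: p hb => // p hb _.
by have [] := convex_rec hb hx x0 x01 (ltnSn p); lia.
Qed.

(** Equality would make m divide a determinant equal to 1. *)
Lemma min_corner_neighbour g (m : int) : rev_tiling g -> 2 <= m ->
  (forall r c, m <= g r c) -> g 0%N 0%N = m -> m < g 1%N 0%N.
Proof.
move=> hg m2 ge_m g00; rewrite lt_neqAle ge_m andbT; apply/eqP => e.
have := hg 0%N 0%N; rewrite -e g00 [m * _]mulrC -mulrBl => /eqP.
have [h|h] := lerP (g 0%N 1%N - g 1%N 1%N) 0; first by nia.
by nia.
Qed.

(** The case without rows or columns to delete.  The difference D of rows 1 and 0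
    satisfies the same recurrence as the rows, and it starts with
    0 < D 0 <= D 1, so convexity keeps it positive up to column q.  Column q
    thus starts with an increase, and convexity again carries it down to
    row p. *)
Lemma convex_corner_lt g (m : int) (p q : nat) :
    rev_tiling g -> 2 <= m -> (forall r c, m <= g r c) -> g 0%N 0%N = m ->
    (forall r, (r.+1 < p)%N -> 2 <= row_coef g r 0) ->
    (forall c, (c.+1 < q)%N -> 2 <= row_coef (fun r c => g c r) c 0) ->
  (0 < p)%N -> m < g p q.
Proof.
move=> hg m2 ge_m g00 hp hq p0.
have gpos r c : 0 < g r c by have := ge_m r c; lia.
have hgT := rev_tiling_tr hg.
have gposT r c : 0 < (fun r c => g c r) r c by apply: gpos.
have geT r c : m <= (fun r c => g c r) r c by apply: ge_m.
have g10 := min_corner_neighbour hg m2 ge_m g00.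
have g01 := min_corner_neighbour hgT m2 geT g00.
pose D c := g 1%N c - g 0%N c.
have D0 : 0 < D 0%N by rewrite /D; lia.
have D01 : D 0%N <= D 1%N.
  (* The rule at the corner says that m * (D 1 - D 0) is the product of the
     two increments out of the corner, minus 1; both are at least 1. *)
  have := hg 0%N 0%N; rewrite /D g00 => e.
  have h : 0 <= (g 0%N 1%N - m) * (g 1%N 0%N - m) - 1 by nia.
  have : 0 <= m * (g 1%N 1%N - g 1%N 0%N - g 0%N 1%N + m) by nia.
  by rewrite pmulr_rge0; lia.
have Drec c : D c + D c.+2 = row_coef (fun r c => g c r) c 0 * D c.+1.
  rewrite /D mulrBr; have := row_rec c 0 hgT gposT.
  by have := row_rec c 1 hgT gposT => /= <- <-; ring.
have Dq : 0 < D q.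
  case: (posnP q) => [-> //|q0].
  by have := convex_rec_ge hq Drec (ltW D0) D01 q0; lia.
have colrec r := row_rec r q hg gpos.
have := convex_rec_ge hp colrec (ltW (gpos _ _)) _ p0.
by have := ge_m 0%N q; move: Dq; rewrite /D; lia.
Qed.

(** * Reduction to convex rows and columns *)

Lemma bump_last r p : (r < p.-1)%N -> bump r.+1 p.-1 = p.
Proof. by rewrite /bump; lia. Qed.

Lemma row_coef_dichotomy g p : rev_tiling g -> (forall r c, 0 < g r c) ->
  (exists2 r, (r < p.-1)%N & row_coef g r 0 = 1) \/
  (forall r, (r.+1 < p)%N -> 2 <= row_coef g r 0).
Proof.
move=> hg gpos; case: (boolP [exists r : 'I_p.-1, row_coef g r 0 == 1]).
  by case/existsP=> r /eqP e; left; exists r.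
rewrite negb_exists => /forallP h; right => r ltr.
have ltr' : (r < p.-1)%N by lia.
have /= /eqP := h (Ordinal ltr'); have := row_coef_gt0 r hg gpos; lia.
Qed.

(** Rows and columns with coefficient 1 strictly between the two corners are
    removed one at a time, which keeps both corners and all lower bounds. *)
Lemma min_corner_lt g (m : int) (p q : nat) :
    rev_tiling g -> 2 <= m -> (forall r c, m <= g r c) -> g 0%N 0%N = m ->
  (0 < p + q)%N -> m < g p q.
Proof.
move=> + m2; have [n] := ubnP (p + q); elim: n => // n IH in g p q *.
move=> ltn hg ge_m g00 pq0.
have gpos r c : 0 < g r c by have := ge_m r c; lia.
have hgT := rev_tiling_tr hg.
have gposT r c : 0 < (fun r c => g c r) r c by apply: gpos.
case: (row_coef_dichotomy p hg gpos) => [[r ltr a1]|hp].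
  have /= := IH _ p.-1 q _ (rev_tiling_del_row hg gpos a1).
  by rewrite bump_last //; apply=> //; lia.
case: (row_coef_dichotomy q hgT gposT) => [[c ltc a1]|hq].
  have /= := IH _ q.-1 p _ (rev_tiling_del_row hgT gposT a1).
  by rewrite bump_last //; apply=> //; lia.
case: (posnP p) => [p0|p0]; last exact: convex_corner_lt.
by apply: (@convex_corner_lt (fun r c => g c r)) => //; lia.
Qed.

(** * Two minimal entries of a tiling *)

Lemma ratio_lt (x y : nat -> int) (n : nat) :
    (forall k, 0 < x k) -> (forall k, 0 < y k) ->
    (forall k, x k.+1 * y k < x k * y k.+1) ->
  (0 < n)%N -> x n * y 0%N < x 0%N * y n.
Proof.
move=> x0 y0 h; elim: n => // n IH _.
case: (posnP n) => [-> //|n0].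
rewrite -(ltr_pM2r (x0 n)) -(ltr_pM2r (y0 n)).
have l1 := IH n0; have l2 := h n.
have -> : x n.+1 * y 0%N * x n * y n = (x n * y 0%N) * (x n.+1 * y n) by ring.
have -> : x 0%N * y n.+1 * x n * y n = (x 0%N * y n) * (x n * y n.+1) by ring.
by apply: ltr_pM => //; apply: mulr_ge0; apply: ltW.
Qed.

(** Positivity of 2 x 2 determinants passes from adjacent rows to arbitrary ones,
    and then from adjacent columns to arbitrary ones, because it says that
    ratios of positive numbers are strictly monotone, which is transitive. *)
Lemma cross_ratio_lt (h : nat -> nat -> int) (p q : nat) :
    (forall r c, 0 < h r c) ->
    (forall r c, h r c * h r.+1 c.+1 - h r c.+1 * h r.+1 c = 1) ->
  (0 < p)%N -> (0 < q)%N -> h 0%N q * h p 0%N < h 0%N 0%N * h p q.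
Proof.
move=> hpos hh p0 q0.
apply: (@ratio_lt (h 0%N) (h p)) => // c.
rewrite [ltLHS]mulrC; apply: (@ratio_lt (h^~ c) (h^~ c.+1)) => // r.
by have := hh r c; rewrite [h r c.+1 * _]mulrC; lia.
Qed.

Lemma int_shift (i k : int) : i <= k -> exists p : nat, k = i + p%:Z.
Proof. by move=> le_ik; exists `|k - i|%N; lia. Qed.

Lemma min_entry_unique (t : int -> int -> int) (m i j k l : int) :
    is_SL2_tiling t -> 2 <= m -> (forall i j, m <= t i j) ->
    t i j = m -> t k l = m -> (i, j) = (k, l).
Proof.
move=> [tpos tt] m2 ge_m.
(* Within a row, the tie is broken so that reversing the columns applies. *)
wlog ord : i j k l / (i < k) || (i == k) && (l <= j).
  move=> W tij tkl; case: (boolP ((i < k) || (i == k) && (l <= j))) => ord.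
    exact: W.
  by symmetry; apply: W => //; lia.
have le_ik : i <= k by lia.
move=> tij tkl; have [p ek] := int_shift le_ik.
case: (lerP l j) => [le_lj|/[dup] lt_jl /ltW /int_shift [q el]].
  have [q ej] := int_shift le_lj.
  pose g (r c : nat) := t (i + r%:Z) (j - c%:Z).
  have hg : rev_tiling g.
    move=> r c; rewrite /g; have := tt (i + r%:Z) (j - c.+1%:Z).
    have -> : i + r%:Z + 1 = i + r.+1%:Z by lia.
    by have -> : j - c.+1%:Z + 1 = j - c%:Z by lia.
  have g00 : g 0%N 0%N = m by rewrite /g subr0 addr0.
  have gpq : g p q = m by rewrite /g -ek -tkl; congr t; lia.
  case: (posnP (p + q)) => [pq0|pq0]; first by congr pair; lia.
  have := min_corner_lt hg m2 (fun r c => ge_m _ _) g00 pq0.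
  by rewrite gpq ltxx.
pose h (r c : nat) := t (i + r%:Z) (j + c%:Z).
have hh r c : h r c * h r.+1 c.+1 - h r c.+1 * h r.+1 c = 1.
  rewrite /h; have := tt (i + r%:Z) (j + c%:Z).
  have -> : i + r%:Z + 1 = i + r.+1%:Z by lia.
  by have -> : j + c%:Z + 1 = j + c.+1%:Z by lia.
have h00 : h 0%N 0%N = m by rewrite /h !addr0.
have hpq : h p q = m by rewrite /h -ek -el.
have p0 : (0 < p)%N by lia.
have q0 : (0 < q)%N by lia.
have := @cross_ratio_lt h p q (fun r c => tpos _ _) hh p0 q0.
rewrite h00 hpq.
suff : m * m <= h 0%N q * h p 0%N by move=> ?; lia.
by apply: ler_pM; rewrite ?ge_m //; lia.
Qed.

Lemma min_entry_exists (t : int -> int -> int) :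
  (forall i j, 0 < t i j) -> exists m, is_min_of_entries t m.
Proof.
move=> tpos.
suff W (n : nat) i j : t i j <= n%:Z -> exists m, is_min_of_entries t m.
  by apply: (W `|(t 0 0)%R|%N 0 0); lia.
elim: n i j => [|n IH] i j le_n; first by have := tpos i j; lia.
case: (classic (exists k l, t k l < t i j)) => [[k [l lt_kl]]|no_lt].
  by apply: (IH k l); lia.
exists (t i j); split; first by exists i, j.
by move=> k l; rewrite leNgt; apply/negP => lt_kl; apply: no_lt; exists k, l.
Qed.

Theorem lemma12p4 (t : int -> int -> int)
    (ht : is_SL2_tiling t)
    (hno1 : forall i j : int, t i j <> 1) :
  exists m : int, is_min_of_entries t m /\
    exists! bv : int * int, t bv.1 bv.2 = m.
Proof.
have [tpos _] := ht.
have [m [[i [j tij]] ge_m]] := min_entry_exists tpos.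
exists m; split; first by split=> //; exists i, j.
exists (i, j); split=> // -[k l] /= tkl.
apply: (min_entry_unique ht _ ge_m tij tkl).
by have := tpos i j; have := hno1 i j; rewrite tij; lia.
Qed.
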